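(* Let $n$ be a positive integer and let $CE_n$ be the critical exponent for $n$-by-$n$ generalized doubly nonnegative matrices under continuous conventional powers. Then \[ CE_n \le \begin{cases} \dfrac{n^2-3n+4}{2} & \text{if } n \text{ is odd},\\[2mm] \dfrac{n^2-2n}{2} & \text{if } n \text{ is even}. \end{cases} \]
   Context: A real $n$-by-$n$ matrix $A$ is called generalized doubly nonnegative (GDN) if it is entrywise nonnegative, diagonalizable, and all its eigenvalues are (real and) nonnegative. For a GDN matrix $A = SDS^{-1}$ with $D=\operatorname{diag}(\lambda_1,\dots,\lambda_n)$ diagonal, and a real number $\alpha>0$, the continuous (conventional) power is $A^\alpha := S D^\alpha S^{-1}$, where $D^\alpha := \operatorname{diag}(\lambda_1^\alpha,\dots,\lambda_n^\alpha)$ (with $0^\alpha = 0$). The critical exponent $CE_n$ is the least real number $m \ge 0$ such that for every $n$-by-$n$ GDN matrix $A$, the matrix $A^\alpha$ is GDN for all $\alpha > m$. *)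

(* Defs.v *)
From mathcomp Require Import all_boot all_order all_algebra.
From mathcomp Require Import all_classical all_reals all_analysis.

Set Implicit Arguments.
Unset Strict Implicit.
Unset Printing Implicit Defensive.

Import Order.TTheory GRing.Theory Num.Theory.

Local Open Scope classical_set_scope.
Local Open Scope ring_scope.

(* Diagonalizability is over R: this already makes every eigenvalue of A real. *)
Definition GDN (R : realType) (n : nat) (A : 'M[R]_n) : Prop :=
  [/\ forall i j, 0 <= A i j,
      diagonalizable A &
      forall a : R, eigenvalue A a -> 0 <= a].

Definition diagonalizes (R : realType) (n : nat)
    (A S : 'M[R]_n) (d : 'rV[R]_n) : Prop :=
  S \in unitmx /\ A = S *m diag_mx d *m invmx S.

(* [powR] satisfies 0 `^ alpha = 0 for alpha != 0. *)
Definition power_by (R : realType) (n : nat)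
    (S : 'M[R]_n) (d : 'rV[R]_n) (alpha : R) : 'M[R]_n :=
  S *m diag_mx (map_mx (fun x => x `^ alpha) d) *m invmx S.

(* The diagonalization is picked by choice; [cpowE] shows that the value does
   not depend on it.  The value is 0 when A is not diagonalizable. *)
Definition cpow (R : realType) (n : nat) (A : 'M[R]_n) (alpha : R) : 'M[R]_n :=
  xget 0 [set B | exists S d, diagonalizes A S d /\ B = power_by S d alpha].

Lemma power_by_uniq (R : realType) (n : nat) (A S T : 'M[R]_n)
    (d e : 'rV[R]_n) (alpha : R) :
  diagonalizes A S d -> diagonalizes A T e ->
  power_by S d alpha = power_by T e alpha.
Proof.
move=> [uS AS] [uT AT]; pose P := invmx T *m S.
have PDE : P *m diag_mx d = diag_mx e *m P.
  have : A *m S = S *m diag_mx d by rewrite AS mulmxKV.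
  rewrite AT => /(congr1 (mulmx (invmx T))).
  by rewrite !mulmxA mulVmx // mul1mx -!mulmxA => ->.
have PDEa : P *m diag_mx (map_mx (fun x => x `^ alpha) d) =
            diag_mx (map_mx (fun x => x `^ alpha) e) *m P.
  apply/matrixP => i j; rewrite mul_mx_diag mul_diag_mx !mxE.
  move/matrixP/(_ i j): PDE; rewrite mul_mx_diag mul_diag_mx !mxE.
  set p := \sum_k _; have [->|p0] := eqVneq p 0; first by rewrite !mul0r !mulr0.
  by rewrite mulrC => /(mulIf p0) ->; rewrite mulrC.
have ST : S = T *m P by rewrite /P mulmxA mulmxV // mul1mx.
have PS : P *m invmx S = invmx T by rewrite /P mulmxK.
by clearbody P; rewrite /power_by {1}ST -(mulmxA T P) PDEa -!mulmxA PS.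
Qed.

Lemma cpowE (R : realType) (n : nat) (A S : 'M[R]_n) (d : 'rV[R]_n) (alpha : R) :
  diagonalizes A S d -> cpow A alpha = power_by S d alpha.
Proof.
move=> AS; rewrite /cpow; case: xgetP => [B _ [T [e [AT ->]]]|].
  exact: power_by_uniq AT AS.
by move/(_ (power_by S d alpha)); case; exists S, d.
Qed.

Lemma diagonalizable_diagonalizes (R : realType) (n : nat) (A : 'M[R]_n) :
  diagonalizable A <-> exists S d, diagonalizes A S d.
Proof.
split=> [[P uP /(diagonalizable_forLR uP)[d ->]]|[S [d [uS ->]]]].
  exists (invmx P), d; split; first by rewrite unitmx_inv.
  by rewrite mxpoly.conjumx ?unitmx_inv.
exists (invmx S); rewrite ?unitmx_inv //.
apply/diagonalizable_forLR; rewrite ?unitmx_inv //; exists d.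
by rewrite invmxK mxpoly.conjumx.
Qed.

Definition admissible_exponents (R : realType) (n : nat) : set R :=
  [set m : R | 0 <= m /\
    forall A : 'M[R]_n, GDN A -> forall alpha : R, m < alpha -> GDN (cpow A alpha)].

Arguments admissible_exponents : clear implicits.

Definition is_critical_exponent (R : realType) (n : nat) (m : R) : Prop :=
  admissible_exponents R n m /\ lbound (admissible_exponents R n) m.

(* Main.v *)
Require Import Defs.
From mathcomp Require Import all_boot all_order all_algebra.
From mathcomp Require Import all_classical all_reals all_analysis.
From mathcomp Require Import ring lra zify.

Import Order.TTheory GRing.Theory Num.Theory.

Local Open Scope ring_scope.

(* Fix a row i of A^t.  Its entries are exponential sums in t with one term per
   nonzero eigenvalue, nonnegative at the positive integers.  If A^(M+u) has a
   negative entry in row i, where 0 < u < 1, then so does A^(l+u) for each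
   l <= M, for otherwise multiplication by A^(M-l) would make row i of A^(M+u)
   nonnegative.  An entry that is negative at k of the points l+u alternates
   weakly in sign along these points and the k points l+1, and also along one
   more point in front when 0 is not among the l's or A is invertible.  By
   Rolle, a nonzero exponential sum with r terms alternates weakly along at most
   r points.  Summing over the n entries of the row bounds M.  For odd n, all
   off-diagonal entries gain one step over l >= 1: A^0 vanishes there if A is
   invertible, and one exponential term is missing if A is singular. *)

(** * Exponential sums and their weak sign alternations *)

Definition expsum {R : realType} (s : seq (R * R)) (t : R) : R :=
  \sum_(x <- s) x.1 * expR (x.2 * t).

Lemma is_derive_expsum {R : realType} (s : seq (R * R)) (t : R) :
  is_derive t 1 (expsum s) (expsum [seq (x.1 * x.2, x.2) | x <- s] t).
Proof.
elim: s => [|[c a] s IH].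
  have -> : expsum [::] = cst (0 : R).
    by apply/funext => x; rewrite /expsum big_nil.
  exact: is_derive_cst.
have -> : expsum ((c, a) :: s) = c *: (expR \o (fun x => a * x)) + expsum s.
  by apply/funext => x; rewrite /expsum big_cons.
have -> : expsum [seq (x.1 * x.2, x.2) | x <- (c, a) :: s] t =
    c *: (expR (a * t) * a) + expsum [seq (x.1 * x.2, x.2) | x <- s] t.
  by rewrite /expsum big_cons /= /GRing.scale /=; ring.
apply: is_deriveD IH; apply: is_deriveZ; apply: is_derive1_comp => /=.
rewrite -[X in is_derive _ _ _ X]mulr1; exact: is_deriveZ.
Qed.

Lemma expsum_MVT {R : realType} (s : seq (R * R)) (a b : R) : a < b ->
  exists c, [/\ a < c, c < b &
    expsum s b - expsum s a
      = expsum [seq (x.1 * x.2, x.2) | x <- s] c * (b - a)].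
Proof.
move=> ab.
have [||c] := @MVT R (expsum s)
  (expsum [seq (x.1 * x.2, x.2) | x <- s]) a b ab.
- by move=> x _; exact: is_derive_expsum.
- apply: derivable_within_continuous => x _.
  by have [] := is_derive_expsum s x.
- by rewrite in_itv /= => /andP[ac cb] E; exists c.
Qed.

(* Weak alternation: a zero counts as having whichever sign is needed. *)
Fixpoint alternates {R : realType} (f : R -> R) (b : bool) (l : seq R) : Prop :=
  if l is t :: l' then
    (if b then 0 <= f t else f t <= 0) /\ alternates f (~~ b) l'
  else True.

(** By the mean value theorem, the derivative takes, between two neighbouring points, the weak sign
    of the later value. *)
Lemma alternates_derivative {R : realType} (s : seq (R * R)) (b : bool)
    (x : R) (l : seq R) :
  path <%R x l -> alternates (expsum s) b (x :: l) ->
  exists l' : seq R, [/\ path <%R x l', size l' = size l &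
    alternates (expsum [seq (x.1 * x.2, x.2) | x <- s]) (~~ b) l'].
Proof.
set s' := map _ s.
elim: l b x => [|y l IH] b x /=; first by exists [::].
move=> /andP[xy yl] [fx [fy fl]].
have [|l' [pl' sl' al']] := IH (~~ b) y yl; first by split.
have [c [xc cy E]] := expsum_MVT s x y xy.
exists (c :: l'); split => /=.
- rewrite xc /=; case: l' pl' {sl' al'} => //= z l' /andP[yz ->].
  by rewrite (lt_trans cy yz).
- by rewrite sl'.
split; last exact: al'.
have xy0 : 0 < y - x by rewrite subr_gt0.
case: b fx fy {fl al'} => /= fx fy.
  rewrite -(pmulr_lle0 _ xy0) -/s' -E; lra.
rewrite -(pmulr_lge0 _ xy0) -/s' -E; lra.
Qed.

(* Divide by one exponential to make its term constant, then differentiate: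
   this removes one term and costs one alternation point. *)
Lemma alternation_eq0 {R : realType} (s : seq (R * R)) (b : bool) (l : seq R) :
  sorted <%R l -> alternates (expsum s) b l ->
  (size s < size l)%N -> expsum s = cst 0.
Proof.
have [m] := ubnP (size s); elim: m s b l => // m IH [|[c a] s] b l.
  by move=> *; apply/funext => t; rewrite /expsum big_nil.
case: l => // x [|y l] //= sm pl al sl.
pose r := (c, 0) :: [seq (x.1, x.2 - a) | x <- s].
have rE t : expsum ((c, a) :: s) t = expR (a * t) * expsum r t.
  rewrite /expsum !big_cons big_map mulrDr mul0r expR0 mulr1 mulrC; congr +%R.
  rewrite mulr_sumr; apply: eq_bigr => z _ /=.
  by rewrite mulrCA -expRD; congr (_ * expR _); ring.
have {}al : alternates (expsum r) b [:: x, y & l].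
  have + L : forall b', alternates (expsum ((c, a) :: s)) b' L ->
      alternates (expsum r) b' L; last exact.
  elim: L => //= t L IHL b' [ft /IHL fL]; split=> //.
  move: ft; rewrite rE; case: (b').
    by rewrite pmulr_rge0 // expR_gt0.
  by rewrite pmulr_rle0 // expR_gt0.
have [l' [pl' sl' al']] := alternates_derivative r b x (y :: l) pl al.
set r' := map _ r in al'.
have r'0 : expsum r' = cst 0.
  have E : expsum r' = expsum (behead r').
    by apply/funext => t; rewrite /expsum big_cons /= mulr0 mul0r add0r.
  rewrite E; apply: (IH _ (~~ b) l').
  - by rewrite /= !size_map.
  - exact: path_sorted pl'.
  - by rewrite -E.
  - by rewrite /= !size_map sl'.
have rc u v : u < v -> expsum r v = expsum r u.
  move=> /(expsum_MVT r) [w [_ _]].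
  by rewrite -/r' r'0 mul0r => /eqP; rewrite subr_eq0 => /eqP.
have rx t : expsum r t = expsum r x.
  by case: (ltgtP t x) => [/rc|/rc|->].
(* A constant with opposite weak signs at x and y is zero. *)
have rx0 : expsum r x = 0.
  move: al => /= [fx [+ _]]; rewrite rx.
  by apply: contraPP => /eqP; case: (b) fx => /= h1 h2 h3; lra.
by apply/funext => t; rewrite rE rx rx0 mulr0.
Qed.

(** * Sign changes forced by negative values between integers *)

(** The sum will be negative at each [m%:R + u] and nonnegative at each [m.+1%:R]. *)
Definition zigzag {R : realType} (u : R) (ms : seq nat) : seq R :=
  flatten [seq [:: m%:R + u; m.+1%:R] | m <- ms].

Lemma size_zigzag {R : realType} (u : R) (ms : seq nat) :
  size (zigzag u ms) = (2 * size ms)%N.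
Proof. by elim: ms => //= m ms; rewrite /zigzag /= => ->; lia. Qed.

Lemma zigzag_path {R : realType} (u x : R) (ms : seq nat) :
  0 < u < 1 -> sorted ltn ms -> {in ms, forall m : nat, x <= m%:R} ->
  path <%R x (zigzag u ms).
Proof.
move=> /andP[u0 u1]; elim: ms x => //= m ms IH x pm xm.
have xm0 := xm m (mem_head _ _).
apply/and3P; split; first by lra.
  by rewrite -natr1; lra.
apply: IH; first exact: path_sorted pm.
move=> k kms; rewrite ler_nat.
by have /allP/(_ k kms) := order_path_min ltn_trans pm.
Qed.

Section SignChanges.
Variables (R : realType) (s : seq (R * R)) (u : R) (ms : seq nat).
Hypotheses (u01 : 0 < u < 1) (ms_sorted : sorted ltn ms).
Hypothesis expsum_lt0 : {in ms, forall m : nat, expsum s (m%:R + u) < 0}.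
Hypothesis expsum_ge0 : forall m : nat, 0 <= expsum s m.+1%:R.

Let zigzag_alternates : alternates (expsum s) false (zigzag u ms).
Proof.
elim: ms expsum_lt0 => //= m l IH neg.
split; first by rewrite ltW // neg // mem_head.
by split => //; apply: IH => k kl; apply: neg; rewrite in_cons kl orbT.
Qed.

(** Any element of [ms] gives a strictly negative value, so the sum is not identically zero and
    [alternation_eq0] bounds the alternation. *)
Let alternation_size (b : bool) (l : seq R) : ms != [::] ->
  sorted <%R l -> alternates (expsum s) b l -> (size l <= size s)%N.
Proof.
move=> ms0 sl al; rewrite leqNgt; apply/negP => lt.
have s0 := alternation_eq0 s b l sl al lt.
case: ms ms0 expsum_lt0 => // m l' _ /(_ m (mem_head _ _)).
by rewrite s0 ltxx.
Qed.

Lemma sign_changes_le : (2 * size ms <= size s)%N.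
Proof.
have [->|ms0] := eqVneq ms [::]; first by rewrite muln0.
rewrite -(size_zigzag u ms); apply: alternation_size zigzag_alternates => //.
apply: (@path_sorted _ _ 0); apply: zigzag_path => // m _; exact: ler0n.
Qed.

(** The point x put in front will be 1, or 0 when A is invertible. *)
Lemma sign_changes_le1 (x : R) : ms != [::] -> 0 <= expsum s x ->
  {in ms, forall m : nat, x <= m%:R} -> ((2 * size ms).+1 <= size s)%N.
Proof.
move=> ms0 fx xms; rewrite -(size_zigzag u ms).
apply: (alternation_size true (x :: zigzag u ms)) => //.
exact: zigzag_path.
Qed.

(** Meant for x = 0 and y = 1 on an off-diagonal entry of an invertible A: the zero in A^0 counts as
    nonpositive. *)
Lemma sign_changes_le2 (x y : R) : ms != [::] -> x < y ->
  expsum s x <= 0 -> 0 <= expsum s y ->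
  {in ms, forall m : nat, y <= m%:R} -> ((2 * size ms).+2 <= size s)%N.
Proof.
move=> ms0 xy fx fy yms; rewrite -(size_zigzag u ms).
apply: (alternation_size false [:: x, y & zigzag u ms]) => //=.
by rewrite xy; exact: zigzag_path.
Qed.

End SignChanges.

(** * Entries of matrix powers as exponential sums *)

Section Powers.
Variables (R : realType) (n : nat) (S : 'M[R]_n) (d : 'rV[R]_n).

(** Zero eigenvalues are dropped: 0^t = 0 for t != 0 is not of the form exp(t ln x). *)
Definition power_terms (i j : 'I_n) : seq (R * R) :=
  [seq (S i k * invmx S k j, ln (d 0 k)) | k <- enum 'I_n & d 0 k != 0].

Lemma size_power_terms (i j : 'I_n) : (size (power_terms i j) <= n)%N.
Proof.
by rewrite size_map size_filter -[leqRHS](size_enum_ord n) count_size.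
Qed.

Lemma size_power_terms_lt (i j k : 'I_n) : d 0 k = 0 ->
  (size (power_terms i j) < n)%N.
Proof.
move=> dk; rewrite size_map size_filter -[ltnRHS](size_enum_ord n).
rewrite ltn_neqAle count_size andbT -all_count; apply/negP => /allP/(_ k).
by rewrite mem_enum dk eqxx => /(_ isT).
Qed.

Lemma power_byE (t : R) (i j : 'I_n) :
  power_by S d t i j = \sum_k S i k * invmx S k j * d 0 k `^ t.
Proof.
rewrite /power_by mxE; apply: eq_bigr => k _.
by rewrite mul_mx_diag !mxE mulrAC.
Qed.

(** At t = 0 the convention 0^0 = 1 would bring the dropped terms back; hence the alternative. *)
Lemma power_by_expsum (t : R) (i j : 'I_n) :
  t != 0 \/ (forall k, d 0 k != 0) ->
  power_by S d t i j = expsum (power_terms i j) t.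
Proof.
move=> td; rewrite power_byE /expsum big_map big_filter big_enum_cond /=.
rewrite [RHS]big_mkcond /=; apply: eq_bigr => k _.
rewrite /powR; case: eqVneq => [dk|dk] /=; last by rewrite [t * _]mulrC.
by case: td => [/negPf->|/(_ k)]; rewrite ?mulr0 // dk eqxx.
Qed.

Hypothesis S_unit : S \in unitmx.

Lemma power_by0 : power_by S d 0 = 1%:M.
Proof.
rewrite /power_by [map_mx _ _](_ : _ = const_mx 1).
  by rewrite diag_const_mx mulmx1 mulmxV.
by apply/rowP => k; rewrite !mxE powRr0.
Qed.

Lemma power_byD (a b : R) : 0 < a -> 0 < b ->
  power_by S d (a + b) = power_by S d a *m power_by S d b.
Proof.
move=> a0 b0; rewrite /power_by !mulmxA mulmxKV // -[in RHS](mulmxA S).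
rewrite mulmx_diag; congr (_ *m diag_mx _ *m _).
apply/rowP => k; rewrite !mxE powRD //.
by rewrite gt_eqF // addr_gt0.
Qed.

Lemma power_by1 : (forall k, 0 <= d 0 k) ->
  power_by S d 1 = S *m diag_mx d *m invmx S.
Proof.
move=> d0; congr (_ *m diag_mx _ *m _).
by apply/rowP => k; rewrite !mxE powRr1.
Qed.

(** Row i of A^(t+1) is row i of A^t times A, so a single row can be followed. *)
Lemma power_by_row_ge0 (t : R) (m : nat) (i : 'I_n) :
  (forall j k, 0 <= power_by S d 1 j k) -> 0 < t ->
  (forall j, 0 <= power_by S d t i j) ->
  forall j, 0 <= power_by S d (t + m%:R) i j.
Proof.
move=> A0 t0 At; elim: m => [|m IH] j; first by rewrite addr0.
rewrite -natr1 addrA power_byD ?ltr_wpDr // mxE.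
by apply: sumr_ge0 => k _; rewrite mulr_ge0.
Qed.

(** Eigenvectors are rows: v S is one for the diagonal matrix, and any nonzero coordinate of it
    identifies a; conversely, row k of S^-1 is an eigenvector for [d 0 k]. *)
Lemma eigenvalue_diag (a : R) :
  eigenvalue (S *m diag_mx d *m invmx S) a <-> exists k, a = d 0 k.
Proof.
split=> [/eigenvalueP[v vA v0]|[k ->]].
  pose w := v *m S.
  have w0 : w != 0.
    by apply: contraNneq v0 => w0; rewrite -(mulmxK S_unit v) -/w w0 mul0mx.
  have wd : w *m diag_mx d = a *: w.
    by rewrite /w scalemxAl -vA !mulmxA mulmxKV.
  have /rV0Pn[k wk] := w0; exists k.
  clearbody w; move/rowP/(_ k): wd; rewrite mul_mx_diag !mxE => wd.
  by apply: (mulIf wk); rewrite -wd mulrC.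
apply/eigenvalueP; exists (row k (invmx S)).
  rewrite -row_mul !mulmxA mulVmx // mul1mx row_mul row_diag_mx.
  by rewrite -scalemxAl -rowE.
apply/eqP => Sk.
have /rowP/(_ k) : row k (invmx S) *m S = row k 1%:M by rewrite -row_mul mulVmx.
by rewrite Sk mul0mx !mxE eqxx => /eqP; rewrite eq_sym oner_eq0.
Qed.

End Powers.

Arguments power_terms {R n}.

(** * Counting the negative entries along one row *)

(** For odd n: [n./2] indices l for the diagonal entry, [n./2.-1] for each other entry, and one more
    since l starts at 1. For even n: [n./2.-1] for every entry. *)
Definition exponent_bound (n : nat) : nat :=
  if odd n then (n./2 + n.-1 * n./2.-1).+1 else (n * n./2.-1)%N.

Lemma sum_size_fibers (n : nat) (f : nat -> 'I_n) (s : seq nat) :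
  (\sum_j size [seq l <- s | f l == j])%N = size s.
Proof.
under eq_bigr do rewrite size_filter.
elim: s => [|l s IH] /=; first by rewrite big1.
rewrite big_split /= IH (bigD1 (f l)) //= eqxx big1 ?addn0 // => j.
by rewrite eq_sym => /negPf ->.
Qed.

Section NonnegativePowers.
Variables (R : realType) (n : nat) (S : 'M[R]_n) (d : 'rV[R]_n).
Hypothesis S_unit : S \in unitmx.
Hypothesis power_by1_ge0 : forall i j, 0 <= power_by S d 1 i j.

Lemma power_by_nat_ge0 (m : nat) (i j : 'I_n) : 0 <= power_by S d m.+1%:R i j.
Proof.
rewrite -nat1r; exact: power_by_row_ge0.
Qed.

Lemma power_by_ge0 (alpha : R) (i j : 'I_n) :
  (exponent_bound n)%:R < alpha -> 0 <= power_by S d alpha i j.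
Proof.
move=> K_alpha; rewrite leNgt; apply/negP => neg.
have alpha0 : 0 < alpha by rewrite (le_lt_trans _ K_alpha).
have /andP[] := truncn_itv (ltW alpha0).
set M := Num.truncn alpha => M_alpha alpha_M.
have KM : (exponent_bound n <= M)%N.
  by rewrite -ltnS -(ltr_nat R) (lt_trans K_alpha).
pose u := alpha - M%:R.
(* If u = 0, alpha is a positive integer, where the entry is nonnegative. *)
have u01 : 0 < u < 1.
  rewrite /u -natr1 in alpha_M *; apply/andP; split; last by lra.
  rewrite subr_gt0 lt_neqAle M_alpha andbT; apply/eqP => E.
  move: neg alpha0; rewrite -E; case: (M) => [|m]; first by rewrite ltxx.
  by rewrite ltNge power_by_nat_ge0.
(* The condition on l sits under the existential so that [choice] gives a total f; beyond M the
   column is arbitrary. *)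
have row_neg (l : nat) :
    exists j' : 'I_n, (l <= M)%N -> power_by S d (l%:R + u) i j' < 0.
  have [lM|] := leqP l M; last by exists j.
  apply: contrapT => nneg; move: neg; rewrite ltNge => /negP; apply.
  have -> : alpha = l%:R + u + (M - l)%:R by rewrite natrB // /u; lra.
  apply: power_by_row_ge0 => //.
    by rewrite ltr_wpDl //; case/andP: u01.
  by move=> k; rewrite leNgt; apply/negP => kneg; apply: nneg; exists k.
have [f fneg] := choice row_neg.
pose F j' := expsum (power_terms S d i j').
have F_lt0 j' a c : (a + c <= M.+1)%N ->
    {in [seq l <- iota a c | f l == j'], forall m : nat, F j' (m%:R + u) < 0}.
  move=> acM l; rewrite mem_filter mem_iota => /andP[/eqP <- lac].
  rewrite /F -power_by_expsum; first by apply: fneg; move: lac acM; clear; lia.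
  by left; rewrite gt_eqF // ltr_wpDl //; case/andP: u01.
have F_ge0 j' (m : nat) : 0 <= F j' m.+1%:R.
  rewrite /F -power_by_expsum; first exact: power_by_nat_ge0.
  by left; rewrite pnatr_eq0.
have F0 j' : (forall k, d 0 k != 0) -> F j' 0 = (i == j')%:R.
  by move=> d0; rewrite /F -power_by_expsum ?power_by0 ?mxE //; right.
have ms_sorted a c j' : sorted ltn [seq l <- iota a c | f l == j'].
  apply: sorted_filter (iota_ltn_sorted a c); exact: ltn_trans.
have d_cases : (forall k, d 0 k != 0) \/ exists k, d 0 k = 0.
  have [|/existsPn h] := boolP [exists k, d 0 k == 0]; last by left.
  by move=> /existsP[k /eqP]; right; exists k.
move: KM; rewrite /exponent_bound.
case: ifPn => [n_odd|n_even] KM.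
- set K := (_ + _)%N in KM.
  (* One index more than the fibers of f can hold together; starting at 1 leaves the points 0 and 1
     free in front. *)
  pose ms j' := [seq l <- iota 1 K.+1 | f l == j'].
  have ms1 j' : {in ms j', forall m : nat, 1 <= m%:R :> R}.
    by move=> m; rewrite mem_filter mem_iota ler1n => /andP[_ /andP[]].
  have ms_lt0 j' := F_lt0 j' 1%N K.+1 KM.
  have ms_le j' : ms j' != [::] ->
      ((2 * size (ms j')).+1 <= size (power_terms S d i j'))%N.
    move=> ms0; apply: (sign_changes_le1 _ _ u _ u01 (ms_sorted 1%N K.+1 j')
      (ms_lt0 j') (F_ge0 j') 1) => //.
      exact: (F_ge0 j' 0%N).
    exact: ms1.
  have ms_diag : (size (ms i) <= n./2)%N.
    have [->//|ms0] := eqVneq (ms i) [::].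
    move: (ms_le _ ms0) (size_power_terms _ _ S d i i); clear; lia.
  (* With c the size of the fiber, both cases give 2c + 2 <= n. *)
  have ms_offdiag j' : j' != i -> (size (ms j') <= n./2.-1)%N.
    move=> ji; have [->//|ms0] := eqVneq (ms j') [::].
    have [d0|[k dk]] := d_cases.
      have : ((2 * size (ms j')).+2 <= size (power_terms S d i j'))%N.
        apply: (sign_changes_le2 _ _ u _ u01 (ms_sorted 1%N K.+1 j') (ms_lt0 j')
          (F_ge0 j') 0 1) => //.
          by have := F0 j' d0; rewrite eq_sym (negPf ji) /F => ->.
          exact: (F_ge0 j' 0%N).
        exact: ms1.
      move: (size_power_terms _ _ S d i j'); clear -n_odd; lia.
    move: (ms_le _ ms0) (size_power_terms_lt _ _ S d i j' k dk).
    by clear -n_odd; lia.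
  have sum_offdiag : (\sum_(j' | j' != i) size (ms j') <= n.-1 * n./2.-1)%N.
    apply: (@leq_trans (\sum_(j' | j' != i) n./2.-1)%N); first exact: leq_sum.
    by rewrite sum_nat_const cardC1 card_ord.
  have := leq_add ms_diag sum_offdiag.
  have -> : (size (ms i) + \sum_(j' | j' != i) size (ms j'))%N = K.+1.
    have := sum_size_fibers n f (iota 1 K.+1).
    by rewrite (bigD1 i) //= size_iota.
  by rewrite ltnn.
- set K := (_ * _)%N in KM.
  pose ms j' := [seq l <- iota 0 K.+1 | f l == j'].
  have ms_lt0 j' := F_lt0 j' 0%N K.+1 KM.
  (* With c the size of the fiber, the invertible case gives 2c + 1 <= n and the singular one 2c <
     n; as n is even, both yield 2c + 2 <= n. *)
  have ms_le j' : (size (ms j') <= n./2.-1)%N.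
    have [->//|ms0] := eqVneq (ms j') [::].
    have [d0|[k dk]] := d_cases.
      have : ((2 * size (ms j')).+1 <= size (power_terms S d i j'))%N.
        apply: (sign_changes_le1 _ _ u _ u01 (ms_sorted 0%N K.+1 j') (ms_lt0 j')
          (F_ge0 j') 0) => //.
        by have := F0 j' d0; rewrite /F => ->.
      move: (size_power_terms _ _ S d i j'); clear -n_even; lia.
    have : (2 * size (ms j') <= size (power_terms S d i j'))%N.
      exact: (sign_changes_le _ _ u _ u01 (ms_sorted _ _ j') (ms_lt0 j')
        (F_ge0 j')).
    by move: (size_power_terms_lt _ _ S d i j' k dk); clear -n_even; lia.
  have : (\sum_j' size (ms j') <= n * n./2.-1)%N.
    apply: (@leq_trans (\sum_(j' < n) n./2.-1)%N); first exact: leq_sum.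
    by rewrite sum_nat_const card_ord.
  by rewrite sum_size_fibers size_iota ltnn.
Qed.

End NonnegativePowers.

(** * From the entrywise bound to the critical exponent *)

Lemma GDN_cpow (R : realType) (n : nat) (A : 'M[R]_n) (alpha : R) :
  GDN A -> (exponent_bound n)%:R < alpha -> GDN (cpow A alpha).
Proof.
move=> [A0 /diagonalizable_diagonalizes[S [d AS]] Aev] K_alpha.
have [S_unit AE] := AS.
have d0 k : 0 <= d 0 k.
  by apply: Aev; rewrite AE; apply/eigenvalue_diag => //; exists k.
rewrite (cpowE _ AS); split.
- move=> i j; apply: power_by_ge0 => // i' j'.
  by rewrite power_by1 // -AE.
- apply/diagonalizable_diagonalizes.
  by exists S, (map_mx (fun x => x `^ alpha) d); split.
- move=> a /eigenvalue_diag; case=> // k ->.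
  by rewrite mxE powR_ge0.
Qed.

Lemma exponent_boundE (R : realType) (n : nat) : (0 < n)%N ->
  (exponent_bound n)%:R = if odd n then (n%:R ^+ 2 - 3 * n%:R + 4) / 2
           else (n%:R ^+ 2 - 2 * n%:R) / 2 :> R.
Proof.
rewrite /exponent_bound => n0; case: ifP => n_odd.
  have : (2 * (n./2 + n.-1 * n./2.-1).+1 + 3 * n = n ^ 2 + 4)%N.
    have [p ->] : exists p, n = p.*2.+1 by exists n./2; lia.
    have -> : p.*2.+1./2 = p by lia.
    by case: p => [//|p]; rewrite /= -mul2n; nia.
  by move/(congr1 (fun m => m%:R : R)); rewrite !(natrD, natrM, natrX); lra.
have : (2 * (n * n./2.-1) + 2 * n = n ^ 2)%N.
  have [p ->] : exists p, n = p.+1.*2 by exists n./2.-1; lia.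
  have -> : p.+1.*2./2 = p.+1 by lia.
  by rewrite -mul2n /=; nia.
by move/(congr1 (fun m => m%:R : R)); rewrite !(natrD, natrM, natrX); lra.
Qed.

(** The infimum is attained because admissibility only concerns alpha strictly above it, and some
    admissible m lies below such an alpha. *)
Lemma admissible_inf (R : realType) (n : nat) (K : R) :
  admissible_exponents R n K ->
  is_critical_exponent n (inf (admissible_exponents R n)) /\
    inf (admissible_exponents R n) <= K.
Proof.
move=> EK; set E := admissible_exponents R n.
have lbE : has_lbound E by exists 0 => m [].
have lb : lbound E (inf E) by move=> m; exact: ge_inf.
split; last exact: lb.
split=> //; split.
  by apply: lb_le_inf => [|m []]; [exists K|].
move=> A GA alpha lt_alpha.
have [m [_ Em] m_alpha] : exists2 m, E m & m < alpha.
  by apply: inf_lt => //; exists K.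
exact: Em.
Qed.

Theorem theorem3p3 (R : realType) (n : nat) (n_gt0 : (0 < n)%N) :
  exists CE : R, is_critical_exponent n CE /\
    CE <= (if odd n then (n%:R ^+ 2 - 3 * n%:R + 4) / 2
           else (n%:R ^+ 2 - 2 * n%:R) / 2).
Proof.
exists (inf (admissible_exponents R n)).
rewrite -(exponent_boundE R n n_gt0); apply: admissible_inf.
by split=> // A GA alpha; exact: GDN_cpow.
Qed.
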